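(* Let $n\ge 1$, $w\in\mathbb{R}^n$, $a\in\{0,1\}^n$, let $b\ge 0$ be an integer, and consider the problem $$\max\ \sum_{i=1}^n w_ix_i\quad\text{s.t.}\quad \sum_{i=1}^n a_ix_i\le b,\quad x\in\{0,1\}^n. \qquad (\mathrm{P})$$ Let $M\ge 0$ be an integer, and for $(x,y)\in[0,1]^n\times[0,1]^{M+1}$ let $$s(y):=\sum_{\ell=0}^M 2^\ell y_\ell,\qquad r(x,y):=a^\top x+s(y)-b,$$ $$V_{\mathrm{be}}(x,y):=r(x,y)^2-\sum_{i=1}^n a_ix_i^2+\sum_{i=1}^n a_ix_i,\qquad \hat f(x,y):=-w^\top x+\gamma V_{\mathrm{be}}(x,y),$$ with penalty weight $\gamma>0$. Assume that every local minimizer $(x^\star,y^\star)$ of $\hat f$ over $[0,1]^n\times[0,1]^{M+1}$ has binary core, i.e. $x^\star\in\{0,1\}^n$. If $\gamma>\max_i w_i$, then for every local minimizer $(x^\star,y^\star)$ of $\hat f$ over $[0,1]^n\times[0,1]^{M+1}$, the point $x^\star$ is feasible for $(\mathrm{P})$.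
   Context: A local minimizer over the box is a point of the box minimizing $\hat f$ among all points of the box in some neighborhood of it. The variables $x$ are the core (decision) variables and $y$ are slack bits. *)

(* Defs.v *)
From mathcomp Require Import all_boot all_order all_algebra.
From mathcomp Require Import all_classical all_reals all_analysis.

Set Implicit Arguments.
Unset Strict Implicit.
Unset Printing Implicit Defensive.

Import Order.TTheory GRing.Theory Num.Theory.
Import numFieldNormedType.Exports.
Local Open Scope classical_set_scope.
Local Open Scope ring_scope.

Definition dotr (R : realType) (n : nat) (u v : 'rV[R]_n) : R :=
  \sum_(i < n) u 0 i * v 0 i.

Definition binary (R : realType) (n : nat) (x : 'rV[R]_n) : Prop :=
  forall i, x 0 i = 0 \/ x 0 i = 1.

Definition unit_box (R : realType) (n : nat) : set 'rV[R]_n :=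
  [set x | forall i, 0 <= x 0 i <= 1].
Arguments unit_box : clear implicits.

(* The first entry serves only as the seed of the iterated maximum: no value
   other than an entry of [w] takes part in it. *)
Definition max_entry (R : realType) (n : nat) (n_gt0 : (0 < n)%N)
    (w : 'rV[R]_n) : R :=
  \big[Num.max/w 0 (Ordinal n_gt0)]_(i < n) w 0 i.

Definition feasible (R : realType) (n : nat) (a : 'rV[R]_n) (b : nat)
    (x : 'rV[R]_n) : Prop :=
  binary x /\ dotr a x <= b%:R.

Definition slack (R : realType) (M : nat) (y : 'rV[R]_M.+1) : R :=
  \sum_(l < M.+1) 2 ^+ l * y 0 l.

Definition residual (R : realType) (n M : nat) (a : 'rV[R]_n) (b : nat)
    (z : 'rV[R]_n * 'rV[R]_M.+1) : R :=
  dotr a z.1 + slack z.2 - b%:R.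

Definition Vbe (R : realType) (n M : nat) (a : 'rV[R]_n) (b : nat)
    (z : 'rV[R]_n * 'rV[R]_M.+1) : R :=
  residual a b z ^+ 2 - \sum_(i < n) a 0 i * z.1 0 i ^+ 2
    + \sum_(i < n) a 0 i * z.1 0 i.

Definition fhat (R : realType) (n M : nat) (w a : 'rV[R]_n) (b : nat)
    (gamma : R) (z : 'rV[R]_n * 'rV[R]_M.+1) : R :=
  - dotr w z.1 + gamma * Vbe a b z.

Definition local_minimizer (R : realType) (T : topologicalType)
    (D : set T) (f : T -> R) (z : T) : Prop :=
  D z /\ \forall z' \near z, D z' -> f z <= f z'.

(* Main.v *)
(* At a binary infeasible core the residual is at least 1 and some i has
   a_i = x_i = 1. Along x - t e_i the quadratic terms of the penalty cancel, so
   the objective changes by exactly t (w_i + gamma (1 - 2 r)), which is at most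
   t (w_i - gamma) < 0. *)
Require Import Defs.
From mathcomp Require Import all_boot all_order all_algebra.
From mathcomp Require Import all_classical all_reals all_analysis.
From mathcomp Require Import ring lra.

Import Order.TTheory GRing.Theory Num.Theory.
Import numFieldNormedType.Exports.
Local Open Scope classical_set_scope.
Local Open Scope ring_scope.

Lemma le_max_entry (R : realType) (n : nat) (n_gt0 : (0 < n)%N)
    (w : 'rV[R]_n) (i : 'I_n) : w 0 i <= max_entry n_gt0 w.
Proof. by rewrite /max_entry; apply: le_bigmax. Qed.

(** Each product of two bits is 0 or 1, so the sum counts the indices where it is 1. Integrality is
    what turns a violated constraint into a violation by at least 1. *)
Lemma dotr_binary_nat (R : realType) (n : nat) (a x : 'rV[R]_n) :
  binary a -> binary x -> exists k : nat, dotr a x = k%:R.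
Proof.
move=> a_bin x_bin.
exists (\sum_(i < n) (a 0 i * x 0 i == 1)%R)%N.
rewrite natr_sum; apply: eq_bigr => i _.
case: (a_bin i) => ->; case: (x_bin i) => ->;
  by rewrite ?(mul0r, mulr0, mulr1, eqxx) // eq_sym oner_eq0.
Qed.

Lemma slack_ge0 (R : realType) (M : nat) (y : 'rV[R]_M.+1) :
  unit_box R M.+1 y -> 0 <= slack y.
Proof.
move=> y_box; apply: sumr_ge0 => l _.
by apply: mulr_ge0; [exact: exprn_ge0 | case/andP: (y_box l)].
Qed.

Definition lower_entry {R : realType} {n : nat} (x : 'rV[R]_n) (i : 'I_n)
    (t : R) : 'rV[R]_n :=
  x - t *: delta_mx 0 i.

Lemma lower_entryE (R : realType) (n : nat) (x : 'rV[R]_n) (i j : 'I_n)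
    (t : R) :
  lower_entry x i t 0 j = if j == i then x 0 i - t else x 0 j.
Proof.
rewrite !mxE eqxx /=; case: eqP => [->|_]; first by rewrite mulr1.
by rewrite mulr0 subr0.
Qed.

(** Only the summand at [i] changes. A general [F] covers both the linear and the quadratic sums of
    [fhat]. *)
Lemma sum_lower_entry (R : realType) (n : nat) (x : 'rV[R]_n) (i : 'I_n)
    (t : R) (F : 'I_n -> R -> R) :
  \sum_(j < n) F j (lower_entry x i t 0 j) =
  \sum_(j < n) F j (x 0 j) + (F i (x 0 i - t) - F i (x 0 i)).
Proof.
rewrite (bigD1 i) //= [in RHS](bigD1 i) //= lower_entryE eqxx.
under eq_bigr => j /negbTE ji do rewrite lower_entryE ji.
by ring.
Qed.

(** The residual [r] drops by [t], so its square changes by [t^2 - 2 t r]; the term [x_i - x_i^2]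
    rises from 0 to [t - t^2], which cancels [t^2]. *)
Lemma fhat_lower_entry (R : realType) (n M : nat) (w a x : 'rV[R]_n)
    (y : 'rV[R]_M.+1) (b : nat) (gamma t : R) (i : 'I_n) :
  a 0 i = 1 -> x 0 i = 1 ->
  fhat w a b gamma (lower_entry x i t, y) =
  fhat w a b gamma (x, y)
    + t * (w 0 i + gamma * (1 - 2 * residual a b (x, y))).
Proof.
move=> ai xi; rewrite /fhat /Vbe /residual /dotr /=.
rewrite (sum_lower_entry _ _ x i t (fun j u => w 0 j * u)).
rewrite (sum_lower_entry _ _ x i t (fun j u => a 0 j * u)).
rewrite (sum_lower_entry _ _ x i t (fun j u => a 0 j * u ^+ 2)).
by rewrite ai xi; ring.
Qed.

Lemma lower_entry_cvg (R : realType) (n : nat) (x : 'rV[R]_n) (i : 'I_n) :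
  lower_entry x i t @[t --> (0 : R)] --> x.
Proof.
rewrite -[X in _ --> X](subr0 x) -[X in _ - X](scale0r (delta_mx 0 i)).
by apply: cvgB; [exact: cvg_cst | apply: cvgZr_tmp; exact: cvg_id].
Qed.

Theorem theorem3p6 (R : realType) (n : nat) (n_gt0 : (0 < n)%N)
    (w a : 'rV[R]_n) (a_bin : binary a) (b M : nat)
    (gamma : R) (gamma_gt0 : 0 < gamma)
    (binary_core : forall z : 'rV[R]_n * 'rV[R]_M.+1,
      local_minimizer (unit_box R n `*` unit_box R M.+1)
        (fhat w a b gamma) z -> binary z.1)
    (gamma_gt_max : max_entry n_gt0 w < gamma) :
  forall z : 'rV[R]_n * 'rV[R]_M.+1,
    local_minimizer (unit_box R n `*` unit_box R M.+1)
      (fhat w a b gamma) z ->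
    feasible a b z.1.
Proof.
move=> z zmin; have x_bin := binary_core z zmin.
split=> //; case: z zmin x_bin => x y [[/= x_box y_box] xy_min] /= x_bin.
rewrite leNgt; apply/negP => infeas.
have r_ge1 : 1 <= residual a b (x, y).
  have [k ax_k] := dotr_binary_nat _ _ _ _ a_bin x_bin.
  have := slack_ge0 _ _ _ y_box.
  (* Over the naturals [b < k] means [b + 1 <= k]; the nonnegative slack can only enlarge the
     residual. *)
  move: infeas; rewrite /residual /= ax_k ltr_nat -(ler_nat R) -natr1.
  by lra.
have [i /andP[/eqP ai /eqP xi]] : exists i, (a 0 i == 1) && (x 0 i == 1).
  (* Without such an index every product vanishes, and [0 <= b] would make the core feasible. *)
  apply/existsP; apply: contraTT infeas; rewrite -leNgt => /existsPn no_i.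
  rewrite /dotr big1 ?ler0n // => j _; move: (no_i j).
  by case: (a_bin j) => ->; case: (x_bin j) => ->;
    rewrite ?(mul0r, mulr0, eqxx).
have path_cvg : (lower_entry x i t, y) @[t --> (0 : R)^'+] --> (x, y).
  apply: (@cvg_pair _ _ _ _ (nbhs x) (nbhs y)); last exact: cvg_cst.
  by apply: cvg_at_right_filter; exact: lower_entry_cvg.
(* A single [t] suffices, since the change of [fhat] is linear in [t]; [t <= 1] keeps the lowered
   entry [1 - t] in the unit interval. *)
have [t [t_gt0 t_le1 fmin]] : exists t : R, [/\ 0 < t, t <= 1 &
    (unit_box R n `*` unit_box R M.+1) (lower_entry x i t, y) ->
    fhat w a b gamma (x, y) <= fhat w a b gamma (lower_entry x i t, y)].
  have near_min := path_cvg _ xy_min.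
  apply: (@filter_ex _ (0 : R)^'+); near=> t; split.
  - by near: t; exact: nbhs_right_gt.
  - by near: t; exact: nbhs_right_le.
  - by near: t; exact: near_min.
have /fmin : (unit_box R n `*` unit_box R M.+1) (lower_entry x i t, y).
  split=> //= j; rewrite lower_entryE; case: eqP => _; last exact: x_box.
  by rewrite xi; lra.
(* Dividing by [t > 0], minimality says [0 <= w_i + gamma (1 - 2 r)], whereas [gamma <= gamma r]
   bounds the right side by [w_i - gamma < 0]. *)
rewrite fhat_lower_entry // lerDl pmulr_rge0 //.
have w_lt := le_lt_trans (le_max_entry _ _ n_gt0 w i) gamma_gt_max.
have := ler_wpM2l (ltW gamma_gt0) r_ge1.
by lra.
Unshelve. all: by end_near.
Qed.
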